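(* Let $d$ and $t$ be positive integers, let $n_1,n_2,\dots,n_t$ be natural numbers, let $h_1,\dots,h_t\in\mathbb{R}^d$, and let $f:\mathbb{R}^d\to\mathbb{R}$ be a continuous function satisfying $$\Delta_{h_k}^{n_k+1}f(x)=0$$ for all $x$ in $\mathbb{R}^d$ and for $k=1,\dots,t$. Suppose the additive subgroup $G$ of $\mathbb{R}^d$ generated by $\{h_1,h_2,\dots,h_t\}$ satisfies $\overline{G}=V\oplus\Lambda$, where $\overline{G}$ is the closure of $G$ in the Euclidean topology, $V$ is a vector subspace of $\mathbb{R}^d$, and $\Lambda$ is a discrete additive subgroup of $\mathbb{R}^d$. Then for each $\lambda$ in $\Lambda$ there exists an ordinary polynomial $p_\lambda:\mathbb{R}^d\to\mathbb{R}$ such that $$f(x+\lambda)=p_\lambda(x)$$ holds whenever $x$ is in $V$ and $\lambda$ is in $\Lambda$. Moreover, $$\deg p_\lambda\le n_1+n_2+\dots+n_t+t-1$$ for each $\lambda$ in $\Lambda$. In particular, if $V=\mathbb{R}^d$, then $f$ is an ordinary polynomial. Finally, if $d=1$ and $V=\mathbb{R}$, then $f$ is an ordinary polynomial of degree at most $\min\{n_k:k=1,\dots,t\}$.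
   Context: Natural numbers include $0$. For $h\in\mathbb{R}^d$ the difference operator is $\Delta_h f(x)=f(x+h)-f(x)$, and $\Delta_h^{m}$ is its $m$-fold iterate. An ordinary polynomial on $\mathbb{R}^d$ is a polynomial function in the $d$ coordinates; its degree is its total degree.
   Formalization: In the final claim (d=1, V=R) the degree bound is the minimum of n_k over those k with h_k ≠ 0 rather than over all k, since a zero step imposes no condition (h=(1,√2,0), n=(1,1,0), f(x)=x refutes the original bound). *)

(* Defs.v *)
(* Only the canonical structures and coercions of multinomials' mpoly are imported:
   its notations clash with those of MathComp-Analysis. *)
From HB Require Import structures.
From mathcomp Require Import all_boot all_order all_algebra.
From mathcomp Require Import all_classical all_reals all_analysis.
From mathcomp Require mpoly.
Import (canonicals, coercions) mpoly.

Set Implicit Arguments.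
Unset Strict Implicit.
Unset Printing Implicit Defensive.

Import Order.TTheory GRing.Theory Num.Theory.
Import numFieldNormedType.Exports.

Local Open Scope classical_set_scope.
Local Open Scope ring_scope.

(* R^d is 'rV[R]_d with the sup-norm topology of MathComp-Analysis, which is
   the Euclidean topology. *)

Definition difference (U V : zmodType) (h : U) (f : U -> V) : U -> V :=
  fun x => f (x + h) - f x.

Definition add_subgroup (U : zmodType) (A : set U) : Prop :=
  zmod_closed [in A].

Definition gen_subgroup (U : zmodType) (A : set U) : set U :=
  smallest (@add_subgroup U) A.

Definition discrete_subset (T : topologicalType) (A : set T) : Prop :=
  A `<=` isolated A.

(* Internal direct sum of subgroups of U. *)
Definition is_direct_sum (U : zmodType) (C A B : set U) : Prop :=
  C = [set a + b | a in A & b in B] /\ A `&` B = [set 0].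

Definition ordinary_poly (R : realType) (d : nat) (p : mpoly.mpoly d R) :
    'rV[R]_d -> R :=
  fun x => mpoly.meval (x 0) p.

(* msize is 1 + the total degree, and msize 0 = 0.  The zero polynomial thus
   gets degree 0 here, which is immaterial for upper bounds by naturals. *)
Definition total_degree (R : realType) (d : nat) (p : mpoly.mpoly d R) : nat :=
  (mpoly.msize p).-1.

(* min { n_k : k with h_k != 0 }.  The default value of the iterated minimum is
   max_k n_k, so it does not affect the result unless all the h_k vanish.
   A step h_k = 0 has to be left out: Delta_0^(n_k + 1) f = 0 holds for every f,
   so it bounds no degree.  If no h_k is 0, this is min_k n_k. *)
Definition min_order (U : zmodType) (t : nat) (h : 'I_t -> U)
    (n : 'I_t -> nat) : nat :=
  \big[minn/(\max_(k < t) n k)%N]_(k < t | h k != 0) n k.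

(* Main.v *)
Require Import Defs.
From HB Require Import structures.
From mathcomp Require Import all_boot all_order all_algebra.
From mathcomp Require Import all_classical all_reals all_analysis.
From mathcomp Require mpoly.
Import (canonicals, coercions) mpoly.

Set Implicit Arguments.
Unset Strict Implicit.
Unset Printing Implicit Defensive.

Import Order.TTheory GRing.Theory Num.Theory.
Import numFieldNormedType.Exports.

Local Open Scope classical_set_scope.
Local Open Scope ring_scope.

(** Write D_h for the difference operator with step h and G for the subgroup
    generated by the steps h_k.

    The hypothesis concerns finitely many steps only, but it spreads to the
    whole closure of G: if N = n_1 + ... + n_t + 1, then every N-fold difference
    D_(g_1) ... D_(g_N) f with steps in the closure of G vanishes.  Algebraically,
    for g in G the operator D_g lies in the ideal which the D_(h_k) generate in
    the ring of integral combinations of translations by G, and a product of N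
    generators contains some D_(h_k) at least n_k + 1 times; continuity of f
    takes care of the limits of G.  This is [vanish_closure_gen].

    Since 0 belongs to Lambda, V is contained in the closure of G.  If pi is a
    linear projection onto V, the function x |-> f (pi x + lambda) therefore has
    vanishing N-fold differences for all steps of R^d, and it is continuous.  By
    a theorem of Frechet ([frechet]) it is a polynomial of degree less than N;
    it agrees with x |-> f (x + lambda) on V.

    Frechet's theorem rests on Newton's forward formula
      g (x + s h) = sum_(k < N) binomial(s, k) (D_h^k g)(x).
    For natural s it is Pascal's rule.  It extends to real s ([newton_real])
    because the formulas for the steps h and h / D, where D is a positive
    integer, are polynomials in s which agree at all naturals, hence
    everywhere; this gives the rational s, and continuity gives the rest.
    Applied to one coordinate at a time, the formula exhibits g as a polynomial;
    the k-th coefficient has vanishing differences of order N - k, which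
    compensates the degree k of binomial(s, k).

    If d = 1 and V is the whole line, the same formula at x = 0 with a nonzero
    step h = h_k has no terms beyond the n_k-th, so that f has degree at most
    n_k. *)

(** * Differences and Newton's forward formula over the naturals *)

Section Newton.
Variables (U V : zmodType).
Implicit Types (g F : U -> V) (h u v x : U).

Lemma differenceC h u F :
  difference h (difference u F) = difference u (difference h F).
Proof.
apply/funext => x; rewrite /difference (addrAC x u) !opprB.
by rewrite addrACA [RHS]addrACA; congr (_ + _); exact: addrC.
Qed.

Lemma iter_difference_const k h : iter k (difference h) (fun=> 0 : V) = fun=> 0.
Proof.
by elim: k => //= k ->; apply/funext => x; rewrite /difference subrr.
Qed.

Lemma newton_nat M g h (gM : forall x, iter M (difference h) g x = 0) x a :
  g (x + h *+ a) = \sum_(k < M) iter k (difference h) g x *+ 'C(a, k).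
Proof.
elim: a x => [|a IHa] x.
  rewrite addr0; case: M gM => [|M] gM; first by rewrite big_ord0 [LHS]gM.
  by rewrite big_ord_recl big1 ?addr0 // => k _; rewrite mulr0n.
(* Move the base point to x + h; comparing coefficients is Pascal's rule, and
   the term of index M that the shift of indices produces vanishes. *)
rewrite mulrS addrA IHa.
have shift k : iter k (difference h) g (x + h) =
    iter k (difference h) g x + iter k.+1 (difference h) g x.
  by rewrite [RHS]addrC subrK.
under eq_bigr => k _ do rewrite shift mulrnDl.
rewrite big_split /=.
case: M gM {IHa} => [|M] gM; first by rewrite !big_ord0 addr0.
rewrite [X in _ + X]big_ord_recr /= -iterS gM mul0rn addr0.
rewrite [RHS]big_ord_recl [X in X + _ = _]big_ord_recl /= !bin0 -addrA; congr (_ + _).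
by rewrite -big_split; apply: eq_bigr => k _; rewrite /= /bump binS mulrnDr.
Qed.

End Newton.

(** * Newton polynomials *)

Definition ffactr (A : pzRingType) (a : A) (k : nat) : A :=
  \prod_(i < k) (a - i%:R).

Lemma ffactr_nat (A : pzRingType) (a k : nat) : ffactr a%:R k = (a ^_ k)%:R :> A.
Proof.
elim: k => [|k IHk]; first by rewrite /ffactr big_ord0.
rewrite /ffactr big_ord_recr -/(ffactr _ _) /= IHk ffactnSr natrM.
have [ka|ak] := leqP k a; first by rewrite natrB.
by rewrite ffact_small // !mul0r.
Qed.

Lemma rmorph_ffactr (A B : pzRingType) (phi : {rmorphism A -> B}) a k :
  phi (ffactr a k) = ffactr (phi a) k.
Proof.
by rewrite rmorph_prod; apply: eq_bigr => i _; rewrite rmorphB rmorph_nat.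
Qed.

Section NewtonPoly.
Variable R : realType.
Implicit Types (c : nat -> R) (M : nat).

Definition newton_poly M c : {poly R} :=
  \sum_(k < M) (c k / k`!%:R) *: ffactr 'X k.

Lemma horner_newton_poly M c t :
  (newton_poly M c).[t] = \sum_(k < M) c k / k`!%:R * ffactr t k.
Proof.
rewrite horner_sum; apply: eq_bigr => k _.
by rewrite hornerZ -horner_evalE rmorph_ffactr /= horner_evalE hornerX.
Qed.

Lemma horner_newton_poly_nat M c (a : nat) :
  (newton_poly M c).[a%:R] = \sum_(k < M) c k *+ 'C(a, k).
Proof.
rewrite horner_newton_poly; apply: eq_bigr => k _.
rewrite ffactr_nat -bin_ffact natrM mulrA mulrAC.
by rewrite mulfVK ?pnatr_eq0 -?lt0n ?fact_gt0 // mulr_natr.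
Qed.

(** A difference of two such polynomials has infinitely many roots. *)
Lemma poly_eq_nat (p q : {poly R}) : (forall a : nat, p.[a%:R] = q.[a%:R]) -> p = q.
Proof.
move=> pq; apply/eqP; rewrite -subr_eq0; apply/negPn/negP => r0.
set r := p - q in r0; pose rs := [seq a%:R : R | a <- iota 0 (size r)].
have /(max_poly_roots r0) : all (root r) rs.
  by apply/allP => _ /mapP[a _ ->]; rewrite rootE hornerD hornerN pq subrr.
rewrite map_inj_uniq ?iota_uniq; last by move=> a b /eqP; rewrite eqr_nat => /eqP.
by rewrite size_map size_iota ltnn => /(_ isT).
Qed.

Lemma continuous_eq_rat (phi psi : R -> R) : continuous phi -> continuous psi ->
  (forall q : rat, phi (ratr q) = psi (ratr q)) -> phi =1 psi.
Proof.
move=> cphi cpsi phipsi t; apply/eqP/negPn/negP => ne.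
pose O := (fun s => phi s - psi s) @^-1` [set~ 0].
have oO : open O.
  apply: open_comp => [s _|]; last by apply: closed_openC; exact: closed_eq.
  by apply: cvgB; [exact: cphi|exact: cpsi].
have [|s [Os [q _ qE]]] := @dense_rat R O _ oO.
  by exists t => /= /eqP; rewrite subr_eq0; apply/negP.
by apply: Os; rewrite -qE /= phipsi subrr.
Qed.

End NewtonPoly.

(** * Functions whose N-fold differences vanish *)

(** The steps of an N-fold difference are chosen one by one in S and may differ.
    With S the whole space these are the polynomials of degree less than N in
    the sense of Frechet. *)
Fixpoint differences_vanish (U V : zmodType) (S : set U) (N : nat) (F : U -> V)
    : Prop :=
  if N is N'.+1
  then forall g, S g -> differences_vanish S N' (difference g F)
  else forall x, F x = 0.

Lemma vanish_zero (U V : zmodType) (S : set U) N (F : U -> V) :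
  (forall x, F x = 0) -> differences_vanish S N F.
Proof.
elim: N F => //= N IHN F F0 g _; apply: IHN => x.
by rewrite /difference !F0 subrr.
Qed.

Lemma vanishB (U V : zmodType) (S : set U) N (F F' : U -> V) :
  differences_vanish S N F -> differences_vanish S N F' ->
  differences_vanish S N (fun x => F x - F' x).
Proof.
elim: N F F' => [|N IHN] F F' /= vF vF'; first by move=> x; rewrite vF vF' subrr.
move=> g Sg; have -> : difference g (fun x => F x - F' x) =
    fun x => difference g F x - difference g F' x.
  by apply/funext => x; rewrite /difference opprD addrACA -opprD.
by apply: IHN; [exact: vF|exact: vF'].
Qed.

(** An additive change of variables intertwines the differences.  Besides
    translations, this transports vanishing from a subgroup S to all steps, by
    means of a projection with values in S. *)
Lemma vanish_comp (U U' V : zmodType) (S : set U) (S' : set U') N (F : U -> V)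
    (phi : U' -> U) a :
  {morph phi : x y / x + y} -> (forall x, S' x -> S (phi x)) ->
  differences_vanish S N F -> differences_vanish S' N (fun x => F (phi x + a)).
Proof.
move=> phiD phiS; elim: N F => [|N IHN] F /= vF; first by move=> x.
move=> g /phiS/vF/IHN; rewrite /difference.
by under eq_fun do rewrite addrAC -phiD.
Qed.

Lemma vanish_iter (U V : zmodType) (S : set U) N (F : U -> V) h k :
  S h -> (k <= N)%N -> differences_vanish S N F ->
  differences_vanish S (N - k) (iter k (difference h) F).
Proof.
move=> Sh; elim: k N F => [|k IHk] [|N] F //= kN vF.
by rewrite subSS -iterS iterSr; apply: IHk => //; exact: vF.
Qed.

Lemma vanish_iterT (U V : zmodType) N (F : U -> V) h x :
  differences_vanish setT N F -> iter N (difference h) F x = 0.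
Proof. by move=> vF; have := vanish_iter I (leqnn N) vF; rewrite subnn; apply. Qed.

Lemma continuous_difference (K : numFieldType) (U W : normedModType K) h
    (F : U -> W) : continuous F -> continuous (difference h F).
Proof.
move=> cF x; apply: cvgB; last exact: cF.
apply: (continuous_comp (f := fun y => y + h)); last exact: cF.
by apply: cvgD; [exact: cvg_id|exact: cvg_cst].
Qed.

(** A single step may be replaced by a limit of steps, because the condition
    bears on g |-> D (x + g) - D x for an iterated difference D of F, which is
    continuous; commuting the differences brings g outside. *)
Lemma closed_vanish (K : numFieldType) (U W : normedModType K) (S : set U) N
    (F : U -> W) :
  continuous F -> closed [set g | differences_vanish S N (difference g F)].
Proof.
elim: N F => [|N IHN] F cF /=.
  have -> : [set g | forall x, difference g F x = 0] =
      \bigcap_x (fun g => difference g F x) @^-1` [set 0].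
    by apply/seteqP; split => [g Fg x _|g Fg x]; [exact: Fg|exact: (Fg x I)].
  apply: closed_bigI => x _; apply: closed_comp; last first.
    exact/accessible_closed_set1/hausdorff_accessible/norm_hausdorff.
  move=> g _; apply: cvgB; last exact: cvg_cst.
  apply: (continuous_comp (f := fun g => x + g)); last exact: cF.
  by apply: cvgD; [exact: cvg_cst|exact: cvg_id].
have -> : [set g | forall g', S g' -> differences_vanish S N
                     (difference g' (difference g F))] =
    \bigcap_(g' in S) [set g | differences_vanish S N
                     (difference g (difference g' F))].
  by apply/seteqP; split => g /= + g' Sg' => /(_ _ Sg'); rewrite differenceC.
by apply: closed_bigI => g' _; apply: IHN; exact: continuous_difference.
Qed.

(** The pigeonhole argument, by induction on N.  When N = 0 the bound forces some
    m_k to be 0, so that F = 0.  Otherwise the steps g for which D_g F has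
    vanishing (N-1)-fold differences form a closed subgroup, since D_(u - v) F is
    a difference of translates of D_u F and D_v F.  This subgroup contains every
    h_k, because D_(h_k) F satisfies the hypotheses with m_k lowered by one, so
    it contains the closure of the group generated by the h_k. *)
Lemma vanish_closure_gen (K : numFieldType) (U W : normedModType K) (t : nat)
    (h : 'I_t -> U) (m : 'I_t -> nat) N (F : U -> W) :
  continuous F ->
  (forall k x, iter (m k) (difference (h k)) F x = 0) ->
  (\sum_(k < t) m k < N + t)%N ->
  differences_vanish (closure (gen_subgroup (range h))) N F.
Proof.
elim: N m F => [|N IHN] m F cF mF ltm.
  have [k /eqP m0|m_neq0] := pickP (fun k => m k == 0%N).
    by move=> x /=; have := mF k x; rewrite m0.
  suff : (\sum_(k < t) 1 <= \sum_(k < t) m k)%N.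
    by rewrite sum1_card card_ord leqNgt ltm.
  by apply: leq_sum => k _; rewrite lt0n m_neq0.
set G := gen_subgroup _.
pose A := [set g : U | differences_vanish (closure G) N (difference g F)].
suff GA : G `<=` A.
  have /closure_id AE : closed A by exact: closed_vanish.
  by move=> g Gg; have := closure_subset GA Gg; rewrite -AE.
apply: smallest_sub.
  split=> [|u v]; rewrite ?inE /A /=.
    by apply: vanish_zero => x; rewrite /difference addr0 subrr.
  move=> Au Av.
  have -> : difference (u - v) F =
      fun x => difference u F (x - v) - difference v F (x - v).
    apply/funext => x; rewrite /difference subrK opprB [RHS]addrA subrK.
    by rewrite addrA addrAC.
  by apply: vanishB; [move: Au|move: Av]; exact: (@vanish_comp _ _ _ _ _ _ _ id).
move=> _ [k _ <-]; rewrite /A /=.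
case: (posnP (m k)) => [mk0|mk_gt0].
  (* The truncated m_k - 1 would not lower the sum here, but F is already 0. *)
  apply: vanish_zero => x.
  by have F0 := mF k; rewrite mk0 /= in F0; rewrite /difference !F0 subrr.
apply: (IHN (fun j => m j - (j == k))%N).
- exact: continuous_difference.
- move=> j x; have [->|_] := eqVneq j k; first by rewrite subn1 -iterSr prednK.
  have -> : iter (m j - 0) (difference (h j)) (difference (h k) F) =
      difference (h k) (iter (m j) (difference (h j)) F).
    by rewrite subn0; elim: (m j) => //= i ->; rewrite differenceC.
  by rewrite /difference !mF subrr.
- rewrite (bigD1 k) //= eqxx subn1 (eq_bigr m); last first.
    by move=> j /negPf->; rewrite subn0.
  by move: ltm; rewrite (bigD1 k) //= -{1}(prednK mk_gt0) !addSn ltnS.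
Qed.

(** * Newton's forward formula for real increments *)

Section RealNewton.
Variable R : realType.

(** Newton's formula looks at g along one line at a time.  This form of
    continuity passes at once from f to its composite with the projection onto
    V: a linear map sends lines to lines. *)
Definition line_continuous (E : lmodType R) (g : E -> R) : Prop :=
  forall x v, continuous (fun s : R => g (x + s *: v)).

(** A rational is reached from an integral base point -K by a natural number a of
    steps 1 / D, so Newton's formula over the naturals applies to it even when it
    is negative. *)
Lemma ratr_shifted_frac (q : rat) :
  exists a D K : nat, (0 < D)%N /\ ratr q = a%:R / D%:R - K%:R :> R.
Proof.
have D_gt0 := denq_gt0 q; rewrite /ratr.
case: (denq q) D_gt0 => // D D_gt0; case: (numq q) => m.
  by exists m, D, 0%N; rewrite subr0.
exists (m.+1 * D.-1)%N, D, m.+1; split=> //.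
have D0 : D%:R != 0 :> R by rewrite pnatr_eq0 -lt0n.
apply: (mulIf D0); rewrite mulrBl !mulfVK // NegzE mulrNz.
rewrite -natrM -{2}(prednK (D_gt0 : (0 < D)%N)) mulnS natrD opprD addrCA.
by rewrite subrr addr0.
Qed.

(** At s = a / D - K the left-hand side is computed by the formula for the base
    point x - K h and the step h / D.  As a polynomial in s, that formula agrees
    at the naturals with the one for the base point x and the step h, so the two
    are equal and the identity holds at every rational. *)
Lemma newton_real (E : lmodType R) M (g : E -> R) (h x : E) :
  line_continuous g -> differences_vanish setT M g ->
  forall s, g (x + s *: h) =
            (newton_poly M (fun k => iter k (difference h) g x)).[s].
Proof.
move=> cg vg; apply: continuous_eq_rat; [exact: cg|exact: continuous_horner|].
move=> q; have [a [D [K [D_gt0 ->]]]] := ratr_shifted_frac q.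
have D0 : D%:R != 0 :> R by rewrite pnatr_eq0 -lt0n.
pose y := x - K%:R *: h.
pose P := newton_poly M (fun k => iter k (difference (D%:R^-1 *: h)) g y).
have gP (b : nat) : P.[b%:R] = g (y + (b%:R / D%:R) *: h).
  rewrite horner_newton_poly_nat -newton_nat => [|z]; last exact: vanish_iterT.
  by rewrite -scaler_nat scalerA.
have <- : P \Po (D%:R *: ('X + K%:R%:P)) =
    newton_poly M (fun k => iter k (difference h) g x).
  apply: poly_eq_nat => b; rewrite horner_newton_poly_nat -newton_nat; last first.
    by move=> z; exact: vanish_iterT.
  rewrite horner_comp !hornerE -natrD -natrM gP natrM mulrAC mulfV // mul1r.
  by rewrite natrD scalerDl /y addrACA addNr addr0 scaler_nat.
rewrite horner_comp !hornerE subrK mulrCA mulfV // mulr1 gP.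
by rewrite scalerBl addrA addrAC.
Qed.

End RealNewton.

Lemma line_continuous_difference (R : realType) (E : lmodType R) h (g : E -> R) :
  line_continuous g -> line_continuous (difference h g).
Proof.
move=> cg x v s; apply: cvgB; last exact: cg.
have := cg (x + h) v s; rewrite /continuous_at.
by under eq_fun do rewrite addrAC; rewrite addrAC.
Qed.

Lemma line_continuous_affine (R : realType) (E : lmodType R) (W : normedModType R)
    (f : W -> R) (phi : {linear E -> W}) a :
  continuous f -> line_continuous (fun x => f (phi x + a)).
Proof.
move=> cf x v s; rewrite [X in continuous_at _ X](_ : _ =
    f \o (fun r : R => phi x + r *: phi v + a)).
  apply: continuous_comp; last exact: cf.
  apply: cvgD; last exact: cvg_cst.
  apply: cvgD; first exact: cvg_cst.
  by apply: cvgZl; exact: cvg_id.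
by apply/funext => r /=; rewrite linearD linearZ.
Qed.

(** * Frechet's theorem *)

Section Frechet.
Variables (R : realType) (d : nat).
Implicit Types (p q : mpoly.mpoly d R) (x : 'rV[R]_d).

(** Degrees add, and a size exceeds the degree by one: of the two factors, only
    one contributes its excess. *)
Lemma msizeM_leq p q a b :
  (mpoly.msize p <= a.+1)%N -> (mpoly.msize q <= b)%N ->
  (mpoly.msize (p * q) <= a + b)%N.
Proof.
move=> pa qb; have [->|p0] := eqVneq p 0; first by rewrite mul0r mpoly.msize0.
have [->|q0] := eqVneq q 0; first by rewrite mulr0 mpoly.msize0.
by rewrite mpoly.msizeM // -subn1 leq_subLR add1n -addSn leq_add.
Qed.

Lemma msize_sum_leq n (F : 'I_n -> mpoly.mpoly d R) N :
  (forall k, mpoly.msize (F k) <= N)%N -> (mpoly.msize (\sum_(k < n) F k) <= N)%N.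
Proof.
move=> FN; apply: leq_trans (mpoly.msize_sum _ _ _) _.
exact/bigmax_leqP.
Qed.

Lemma msize_ffactr p k : (mpoly.msize p <= 2)%N -> (mpoly.msize (ffactr p k) <= k.+1)%N.
Proof.
move=> p2; elim: k => [|k IHk]; first by rewrite /ffactr big_ord0 mpoly.msize1.
rewrite /ffactr big_ord_recr -/(ffactr _ _) /= -addn2; apply: msizeM_leq => //.
apply: leq_trans (mpoly.msizeD_le _ _) _; rewrite geq_max p2 mpoly.msizeN.
by rewrite -mpoly.mpolyC_nat mpoly.msizeC; case: eqP.
Qed.

Definition mpoly_coord (i : 'I_d) : mpoly.mpoly d R := mpoly.mpolyX R (mpoly.mnm1 i).

Lemma msize_coord i : mpoly.msize (mpoly_coord i) = 2%N.
Proof. by rewrite mpoly.msizeX mpoly.mdeg1. Qed.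

Lemma eval_coord i x : ordinary_poly (mpoly_coord i) x = x 0 i.
Proof. exact: mpoly.mevalXU. Qed.

Definition truncv (j : nat) x : 'rV[R]_d := \row_i (if (i < j)%N then x 0 i else 0).

(** Induction on the number j of coordinates that are not set to 0.  The
    polynomial p is evaluated at the full vector x, not at its truncation, so
    that p does not involve the coordinates from j on. *)
Lemma frechet_truncv N (g : 'rV[R]_d -> R) (j : nat) :
  (j <= d)%N -> line_continuous g -> differences_vanish setT N g ->
  exists p, (mpoly.msize p <= N)%N /\
            forall x, g (truncv j x) = ordinary_poly p x.
Proof.
elim: j N g => [|j IHj] N g jd cg vg.
  case: N vg => [|N] vg.
    exists 0; rewrite mpoly.msize0; split=> // x.
    by rewrite /ordinary_poly mpoly.meval0 vg.
  exists (mpoly.mpolyC d (g 0)); split=> [|x]; first by rewrite mpoly.msizeC; case: eqP.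
  by rewrite /ordinary_poly mpoly.mevalC; congr g; apply/rowP => i; rewrite !mxE.
pose i := Ordinal jd; pose e : 'rV[R]_d := delta_mx 0 i.
have /choice[P PE] : forall k : 'I_N, exists p, (mpoly.msize p <= N - k)%N /\
    forall x, iter k (difference e) g (truncv j x) = ordinary_poly p x.
  move=> k; apply: IHj; first exact: ltnW.
    elim: (k : nat) => //= l; exact: line_continuous_difference.
  by apply: vanish_iter => //; exact: ltnW.
exists (\sum_(k < N) k`!%:R^-1 *: (ffactr (mpoly_coord i) k * P k)); split.
  apply: msize_sum_leq => k; apply: leq_trans (mpoly.msizeZ_le _ _) _.
  rewrite -{2}(subnKC (ltnW (ltn_ord k))); apply: msizeM_leq.
    by rewrite msize_ffactr // msize_coord.
  by case: (PE k).
move=> x; have -> : truncv j.+1 x = truncv j x + x 0 i *: e.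
  apply/rowP => l; rewrite !mxE /= ltnS leq_eqVlt -val_eqE /=.
  have [lj|] := eqVneq (l : nat) j; last by rewrite mulr0 addr0.
  by rewrite lj ltnn add0r mulr1; congr (x 0 _); apply: val_inj.
(* Newton's formula in the direction e, with the coordinate x 0 i as increment;
   the k-th coefficient is the polynomial P k in the preceding coordinates. *)
rewrite (newton_real _ _ cg vg) horner_newton_poly.
rewrite /ordinary_poly rmorph_sum; apply: eq_bigr => k _.
rewrite /= mpoly.mevalZ mpoly.mevalM rmorph_ffactr /=.
rewrite -!/(ordinary_poly _ _) eval_coord.
have [_ <-] := PE k.
by rewrite mulrAC mulrC; congr (_ * _); exact: mulrC.
Qed.

Theorem frechet N (g : 'rV[R]_d -> R) :
  line_continuous g -> differences_vanish setT N g ->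
  exists p, (mpoly.msize p <= N)%N /\ forall x, g x = ordinary_poly p x.
Proof.
move=> cg vg; have [p [pN pE]] := frechet_truncv (leqnn d) cg vg.
exists p; split=> // x; rewrite -pE; congr g.
by apply/rowP => i; rewrite mxE ltn_ord.
Qed.

End Frechet.

(** The degree is governed by the last nonzero coefficient, not by the number M
    of terms.  This is where a single step of order m smaller than the global
    order M improves the bound on the degree. *)
Lemma newton_mpoly (R : realType) (d m M : nat) (c : nat -> R) (l : mpoly.mpoly d R) :
  (forall k, (m <= k)%N -> c k = 0) -> (mpoly.msize l <= 2)%N ->
  exists p, (mpoly.msize p <= m)%N /\
    forall x, (newton_poly M c).[ordinary_poly l x] = ordinary_poly p x.
Proof.
move=> cm l2; exists (\sum_(k < M) (c k / k`!%:R) *: ffactr l k); split=> [|x].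
  apply: msize_sum_leq => k; have [mk|km] := leqP m k.
    by rewrite cm // mul0r scale0r mpoly.msize0.
  apply: leq_trans (mpoly.msizeZ_le _ _) _.
  exact: leq_trans (msize_ffactr _ l2) km.
rewrite horner_newton_poly /ordinary_poly rmorph_sum; apply: eq_bigr => k _.
by rewrite /= mpoly.mevalZ rmorph_ffactr.
Qed.

(** * The theorem *)

(** The default value of the iterated minimum is at least every n_k, so it never
    lowers the result, and an index minimizing n_k attains it. *)
Lemma min_order_attained (U : zmodType) (t : nat) (h : 'I_t -> U)
    (n : 'I_t -> nat) :
  (exists k, h k != 0) -> exists2 k, h k != 0 & (n k <= min_order h n)%N.
Proof.
case=> k0 hk0; exists [arg min_(k < k0 | h k != 0) n k];
  case: arg_minnP => // k hk kmin.
apply: (big_ind (fun m => n k <= m)%N) => //; first exact: leq_bigmax.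
by move=> a b ka kb; rewrite leq_min ka.
Qed.

Lemma gen_subgroup0 (U : zmodType) (t : nat) (h : 'I_t -> U) :
  (forall k, h k = 0) -> gen_subgroup (range h) `<=` [set 0].
Proof.
move=> h0; apply: smallest_sub => [|_ [k _ <-]]; last exact: h0.
by split=> [|u v]; rewrite ?inE //= => -> ->; rewrite subr0.
Qed.

Theorem corollary6 (R : realType) (d t : nat) (hd : (0 < d)%N) (ht : (0 < t)%N)
    (n : 'I_t -> nat) (h : 'I_t -> 'rV[R]_d) (f : 'rV[R]_d -> R)
    (hf : continuous f)
    (hdiff : forall (k : 'I_t) (x : 'rV[R]_d),
      iter (n k).+1 (difference (h k)) f x = 0)
    (V : {vspace 'rV[R]_d}) (Lambda : set 'rV[R]_d)
    (hLambda : add_subgroup Lambda) (hdiscrete : discrete_subset Lambda)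
    (hG : @is_direct_sum 'rV[R]_d (closure (gen_subgroup (range h)))
                          [set` V] Lambda) :
  [/\ forall lambda : 'rV[R]_d, Lambda lambda ->
        exists p : mpoly.mpoly d R,
          (forall x : 'rV[R]_d, x \in V ->
             f (x + lambda) = ordinary_poly p x) /\
          (total_degree p <= \sum_(k < t) n k + t - 1)%N,
      V = fullv ->
        exists p : mpoly.mpoly d R,
          forall x : 'rV[R]_d, f x = ordinary_poly p x
    & d = 1%N -> V = fullv ->
        exists p : mpoly.mpoly d R,
          (forall x : 'rV[R]_d, f x = ordinary_poly p x) /\
          (total_degree p <= min_order h n)%N].
Proof.
pose G := gen_subgroup (range h); pose N := (\sum_(k < t) n k).+1.
have Lambda0 : Lambda 0 by case: hLambda; rewrite inE.
have VG : [set` V] `<=` closure G.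
  by case: hG => -> _ v Vv /=; exists v => //; exists 0 => //; rewrite addr0.
have vf : differences_vanish (closure G) N f.
  apply: (vanish_closure_gen (m := fun k => (n k).+1) hf hdiff).
  under eq_bigr => k _ do rewrite -addn1.
  by rewrite big_split /= sum1_card card_ord /N addSn.
have poly_slice lambda : exists p : mpoly.mpoly d R, (mpoly.msize p <= N)%N /\
    forall x, f (projv V x + lambda) = ordinary_poly p x.
  apply: frechet.
    exact: (@line_continuous_affine _ _ _ f (projv V) lambda hf).
  apply: vanish_comp vf => [x y|x _]; first exact: linearD.
  by apply: VG => /=; exact: memv_proj.
have part1 lambda : exists p : mpoly.mpoly d R,
    (forall x, x \in V -> f (x + lambda) = ordinary_poly p x) /\
    (total_degree p <= \sum_(k < t) n k + t - 1)%N.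
  have [p [pN pE]] := poly_slice lambda; exists p; split=> [x xV|].
    by rewrite -pE projv_id.
  rewrite /total_degree -subn1 leq_sub2r // (leq_trans pN) // /N -addn1.
  by rewrite leq_add2l.
split=> [lambda _|VT|d1 VT]; first exact: part1.
  have [p [pE _]] := part1 0; exists p => x.
  by rewrite -pE ?addr0 // VT memvf.
(* The h_k are not all 0, since otherwise the closure of G would be {0}. *)
have [k hk kmin] : exists2 k, h k != 0 & (n k <= min_order h n)%N.
  apply: min_order_attained; apply: contrapT => /forallNP h0.
  have : closure G `<=` [set 0].
    rewrite closureE; apply: smallest_sub.
      exact/accessible_closed_set1/hausdorff_accessible/norm_hausdorff.
    by apply: gen_subgroup0 => k; apply/eqP/negPn/negP; exact: h0.
  move/(subset_trans VG)/(_ (const_mx 1)); rewrite VT /= memvf => /(_ isT).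
  move=> /rowP/(_ (Ordinal hd)); rewrite !mxE => /eqP.
  by rewrite oner_eq0.
subst d; pose c := h k 0 0.
have c0 : c != 0.
  apply: contraNneq hk => c0; apply/eqP/rowP => i.
  by rewrite (ord1 i) mxE.
have xE (x : 'rV[R]_1) : x = 0 + (x 0 0 / c) *: h k.
  by rewrite add0r; apply/rowP => i; rewrite (ord1 i) mxE mulfVK.
pose l : mpoly.mpoly 1 R := c^-1 *: mpoly_coord R ord0.
(* Newton's formula at 0 in the direction h k gives a polynomial in
   l = x 0 0 / c; its coefficients vanish beyond the index n k. *)
have [||p [pn pE]] := @newton_mpoly R 1 (n k).+1 N
    (fun i => iter i (difference (h k)) f 0) l.
- move=> i ni; rewrite -(subnK ni) iterD (_ : iter (n k).+1 _ f = fun=> 0).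
    by rewrite iter_difference_const.
  exact/funext/hdiff.
- by rewrite (leq_trans (mpoly.msizeZ_le _ _)) // msize_coord.
exists p; split=> [x|]; last first.
  by rewrite /total_degree (leq_trans _ kmin) // -subn1 leq_subLR add1n.
rewrite -pE {1}(xE x) /ordinary_poly mpoly.mevalZ -/(ordinary_poly _ _) eval_coord.
rewrite [_^-1 * _]mulrC.
have fE : f = fun x => f (idfun x + 0) by apply/funext => y; rewrite addr0.
apply: newton_real; rewrite fE.
  exact: (@line_continuous_affine _ _ _ f idfun 0 hf).
by apply: vanish_comp vf => // y _; apply: VG; rewrite /= VT memvf.
Qed.
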